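(* For every $n\ge 4$, in the edge-distinguishing game (EDGe) played on the wheel graph $W_n$ (with $\lambda(W_n)$ colors), Player 1 has a winning strategy if $n$ is odd, and Player 2 has a winning strategy if $n$ is even.
   Context: The wheel $W_n$ is the join $C_{n-1}\nabla K_1$ of a cycle on $n-1$ vertices with a hub vertex adjacent to all cycle vertices. For a positive integer $k$ let $[k]=\{1,\dots,k\}$. A $k$-coloring $c:V(G)\to[k]$ induces $c'(\{u,v\})=\{c(u),c(v)\}$ (a multiset); $c$ is edge-distinguishing if $c'$ is injective, and $\lambda(G)$ is the least $k$ admitting such a coloring. A partial coloring $c:U\to[k]$, $U\subseteq V(G)$, has partial induced edge coloring equal to the induced edge coloring on $G[U]$. EDGe on $G$: two players, Player 1 first, alternately color an uncolored vertex with a color from $[\lambda(G)]$; a move is legal iff afterwards the partial induced edge coloring of the colored vertices is injective. The player making the last legal move wins. A winning strategy guarantees a win regardless of the opponent's play. *)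

(* Defs.v *)
From mathcomp Require Import all_boot.
From mathcomp Require Import finmap multiset.

Set Implicit Arguments.
Unset Strict Implicit.
Unset Printing Implicit Defensive.

Record sgraph := SGraph {
  vertex :> finType;
  adj : rel vertex;
  adj_sym : symmetric adj;
  adj_irrefl : irreflexive adj }.

Definition edges (G : sgraph) : {set {set G}} :=
  [set e | [exists x, exists y, adj x y && (e == [set x; y])]].

Definition edges_in (G : sgraph) (U : {set G}) : {set {set G}} :=
  [set e in edges G | e \subset U].

(* The cycle C_m for m >= 3; smaller m give degenerate graphs. *)
Definition cycle_adj (m : nat) : rel 'I_m :=
  fun i j => (i != j) && ((j == ordS i) || (i == ordS j)).

Lemma cycle_adj_sym m : symmetric (@cycle_adj m).
Proof. by move=> i j; rewrite /cycle_adj eq_sym orbC. Qed.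

Lemma cycle_adj_irrefl m : irreflexive (@cycle_adj m).
Proof. by move=> i; rewrite /cycle_adj eqxx. Qed.

Definition cycle_graph (m : nat) : sgraph :=
  SGraph (@cycle_adj_sym m) (@cycle_adj_irrefl m).

Definition complete_adj (m : nat) : rel 'I_m := fun i j => i != j.

Lemma complete_adj_sym m : symmetric (@complete_adj m).
Proof. by move=> i j; rewrite /complete_adj eq_sym. Qed.

Lemma complete_adj_irrefl m : irreflexive (@complete_adj m).
Proof. by move=> i; rewrite /complete_adj eqxx. Qed.

Definition complete_graph (m : nat) : sgraph :=
  SGraph (@complete_adj_sym m) (@complete_adj_irrefl m).

Definition join_adj (G H : sgraph) : rel (G + H)%type :=
  fun u v => match u, v with
             | inl x, inl y => adj x y
             | inr x, inr y => adj x y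
             | _, _ => true
             end.

Lemma join_adj_sym G H : symmetric (@join_adj G H).
Proof. by move=> [x|x] [y|y] //=; rewrite adj_sym. Qed.

Lemma join_adj_irrefl G H : irreflexive (@join_adj G H).
Proof. by move=> [x|x] /=; rewrite adj_irrefl. Qed.

Definition join_graph (G H : sgraph) : sgraph :=
  SGraph (@join_adj_sym G H) (@join_adj_irrefl G H).

Definition wheel (n : nat) : sgraph :=
  join_graph (cycle_graph n.-1) (complete_graph 1).

(* For an edge e = {u, v} this is the multiset {c u, c v}. *)
Definition induced_coloring (T : finType) (C : choiceType) (c : T -> C)
  (e : {set T}) : {mset C}%mset := seq_mset [seq c x | x in e].

(* The set of k colors is modelled by 'I_k. *)
Definition edge_distinguishing (G : sgraph) (k : nat) (c : {ffun G -> 'I_k}) :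
  bool := dinjectiveb (induced_coloring c) (mem (edges G)).

Definition edge_colorable (G : sgraph) : pred nat :=
  fun k => (0 < k) && [exists c : {ffun G -> 'I_k}, edge_distinguishing c].

Lemma edge_colorable_ex (G : sgraph) : exists k, edge_colorable G k.
Proof.
exists #|G|.+1; rewrite /edge_colorable /=; apply/existsP.
pose c : {ffun G -> 'I_#|G|.+1} :=
  [ffun x => widen_ord (leqnSn _) (enum_rank x)].
have c_inj : injective c.
  move=> x y; rewrite !ffunE => /(congr1 val) /= /val_inj; exact: enum_rank_inj.
exists c; apply/dinjectiveP => e f _ _ /eq_seq_msetP /perm_mem eq_ef.
by apply/setP => x; have := eq_ef (c x); rewrite !mem_image.
Qed.

Definition lambda (G : sgraph) : nat := ex_minn (edge_colorable_ex G).

Inductive player := Player1 | Player2.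

Section Game.
Variables (G : sgraph) (k : nat).

(* None marks an uncolored vertex. *)
Definition pcoloring := {ffun G -> option 'I_k}.

Definition colored (c : pcoloring) : {set G} := [set x | c x != None].

(* On the edges of the subgraph induced by [colored c] all values of c are of
   the form [Some a], so the multisets below are the induced edge colors up to
   the injection Some. *)
Definition pedge_distinguishing (c : pcoloring) : bool :=
  dinjectiveb (induced_coloring c) (mem (edges_in (colored c))).

Definition move := (G * 'I_k)%type.

Definition start : pcoloring := [ffun=> None].

Definition make_move (c : pcoloring) (m : move) : pcoloring :=
  [ffun x => if x == m.1 then Some m.2 else c x].

Definition legal (c : pcoloring) (m : move) : bool :=
  (m.1 \notin colored c) && pedge_distinguishing (make_move c m).

(* A play is the sequence of moves made so far, in chronological order. *)
Definition position (h : seq move) : pcoloring := foldl make_move start h.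

Definition legal_play (h : seq move) : Prop :=
  forall h1 m h2, h = h1 ++ m :: h2 -> legal (position h1) m.

Definition game_over (h : seq move) : Prop :=
  forall m, ~~ legal (position h) m.

Definition to_move (h : seq move) : player :=
  if odd (size h) then Player2 else Player1.

Definition strategy := seq move -> move.

Definition follows (p : player) (s : strategy) (h : seq move) : Prop :=
  forall h1 m h2, h = h1 ++ m :: h2 -> to_move h1 = p -> m = s h1.

Definition made_last_move (p : player) (h : seq move) : Prop :=
  exists h1 m, h = rcons h1 m /\ to_move h1 = p.

(* The first conjunct forces s to answer legally as long as the game goes on;
   plays cannot last forever, since each move colors a new vertex. *)
Definition winning_strategy (p : player) (s : strategy) : Prop :=
  forall h, legal_play h -> follows p s h ->
    (~ game_over h -> to_move h = p -> legal (position h) (s h)) /\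
    (game_over h -> made_last_move p h).

End Game.

Definition has_winning_strategy (G : sgraph) (p : player) : Prop :=
  exists s : strategy G (lambda G), winning_strategy p s.

(* Main.v *)
Require Import Defs.
From mathcomp Require Import all_boot.
From mathcomp Require Import finmap multiset.

Set Implicit Arguments.
Unset Strict Implicit.
Unset Printing Implicit Defensive.

(** Two rim vertices of equal color would give the hub two spokes of equal
    color, and a rim vertex sharing its color with the hub would conflict at any
    of its rim neighbors; hence at least [n] colors are available.  Once the hub
    is colored, either all [n] vertices end up colored, or some rim vertex
    repeats the hub color and exactly its two rim neighbors stay uncolored.  In
    both cases the number of moves has the parity of [n], so the player favored
    by this parity only has to get the hub colored within the first two moves,
    and may then move arbitrarily. *)

(** * Induced edge colorings of an arbitrary graph *)

Section EdgeColoring.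
Variable G : sgraph.

Lemma induced_coloring2 (C : choiceType) (c : G -> C) (x y : G) :
  x != y -> induced_coloring c [set x; y] = seq_mset [:: c x; c y].
Proof.
move=> xy; apply/eq_seq_msetP; rewrite -[[:: c x; c y]]/(map c [:: x; y]).
apply/perm_map/uniq_perm; rewrite ?enum_uniq //= ?inE ?andbT //.
by move=> z; rewrite mem_enum !inE.
Qed.

Lemma perm_eq2 (C : eqType) (a b a' b' : C) :
  perm_eq [:: a; b] [:: a'; b'] -> (a = a' /\ b = b') \/ (a = b' /\ b = a').
Proof.
have perm1 (x y : C) : perm_eq [:: x] [:: y] -> x = y.
  by move/perm_mem/(_ x); rewrite !inE eqxx => /esym/eqP.
move=> eq_p; have := perm_mem eq_p a.
rewrite !inE eqxx /= => /esym/orP[] /eqP eq_a; subst a.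
  by left; move: eq_p; rewrite perm_cons => /perm1.
right; split=> //; apply: perm1.
by rewrite -(perm_cons b') (perm_trans eq_p) // (perm_catC [:: a'] [:: b']).
Qed.

Lemma adj_neq (x y : G) : adj x y -> x != y.
Proof. by apply: contraTneq => ->; rewrite adj_irrefl. Qed.

Lemma edges_inP (A : {set G}) (e : {set G}) :
  reflect (exists x y, [/\ adj x y, x \in A, y \in A & e = [set x; y]])
          (e \in edges_in A).
Proof.
rewrite !inE; apply: (iffP andP) => [[/existsP[x /existsP[y]]]|[x [y []]]].
  move=> /andP[xy /eqP ->]; rewrite subUset !sub1set => /andP[Ax Ay].
  by exists x, y.
move=> xy Ax Ay ->; rewrite subUset !sub1set Ax Ay; split=> //.
by apply/existsP; exists x; apply/existsP; exists y; rewrite xy eqxx.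
Qed.

(** Quantifying over oriented edges makes it enough to compare endpoint colors in aligned order: a
    crossed match becomes aligned once one edge is reversed. *)
Lemma dinjective_edgesP (C : choiceType) (c : G -> C) (A : {set G}) :
  reflect
    (forall x y z w, adj x y -> adj z w ->
       x \in A -> y \in A -> z \in A -> w \in A ->
       c x = c z -> c y = c w -> [set x; y] = [set z; w])
    (dinjectiveb (induced_coloring c) (mem (edges_in A))).
Proof.
apply: (iffP (dinjectiveP _ _)) => [inj x y z w xy zw Ax Ay Az Aw cx cy | inj].
  apply: inj.
  - by apply/edges_inP; exists x, y.
  - by apply/edges_inP; exists z, w.
  - by rewrite !induced_coloring2 ?adj_neq // cx cy.
move=> e f /edges_inP[x [y [xy Ax Ay ->]]] /edges_inP[z [w [zw Az Aw ->]]].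
rewrite !induced_coloring2 ?adj_neq // => /eq_seq_msetP.
case/perm_eq2=> [[cx cy]|[cx cy]]; first exact: inj.
by rewrite [RHS]setUC; apply: inj; rewrite // adj_sym.
Qed.

(** Makes total colorings the case [A = setT] of the statements about [edges_in A]. *)
Lemma edges_inT : edges_in [set: G] = edges G.
Proof. by apply/setP=> e; rewrite inE subsetT andbT. Qed.

End EdgeColoring.

(** * Plays and legal moves on an arbitrary graph *)

Section Play.
Variables (G : sgraph) (k : nat).
Implicit Types (c : pcoloring G k) (h : seq (move G k)).

Lemma colored_make_move c m : colored (make_move c m) = m.1 |: colored c.
Proof. by apply/setP=> x; rewrite !inE ffunE; case: (x == m.1). Qed.

Lemma position_rcons h m : position (rcons h m) = make_move (position h) m.
Proof. by rewrite /position -cats1 foldl_cat. Qed.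

Lemma colored_position h : colored (position h) = [set x in map fst h].
Proof.
elim/last_ind: h => [|h m IH]; first by apply/setP=> x; rewrite !inE ffunE.
rewrite position_rcons colored_make_move IH; apply/setP=> x.
by rewrite !inE map_rcons mem_rcons inE.
Qed.

Lemma legal_play_rcons h m :
  legal_play (rcons h m) -> legal_play h /\ legal (position h) m.
Proof.
move=> lp; split; last by apply: (lp h m [::]); rewrite cats1.
by move=> h1 m1 h2 def_h; apply: (lp h1 m1 (rcons h2 m)); rewrite def_h rcons_cat.
Qed.

(** Each legal move colors a new vertex, so parity questions about the length of a play become
    questions about the set of colored vertices. *)
Lemma card_colored_position h :
  legal_play h -> #|colored (position h)| = size h.
Proof.
elim/last_ind: h => [|h m IH]; first by rewrite colored_position cards0.
case/legal_play_rcons=> lp /andP[mh _].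
by rewrite position_rcons colored_make_move cardsU1 mh IH // size_rcons.
Qed.

Lemma exists_unused_color c :
  #|colored c| < k -> exists d, forall x, c x != Some d.
Proof.
move=> lt_k; have [/existsP[d /forallP]|] := boolP [exists d, forall x, c x != Some d].
  by exists d.
rewrite negb_exists => /forallP used.
have sub : [set Some d | d in 'I_k] \subset [set c x | x in colored c].
  apply/subsetP=> _ /imsetP[d _ ->].
  have := used d; rewrite negb_forall => /existsP[x]; rewrite negbK => /eqP cx.
  by apply/imsetP; exists x; rewrite ?inE cx.
have := leq_trans (subset_leq_card sub) (leq_imset_card _ _).
by rewrite card_imset ?card_ord 1?leqNgt ?lt_k // => x y [].
Qed.

Lemma pedge_distinguishing_position h :
  0 < size h -> legal_play h -> pedge_distinguishing (position h).
Proof.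
case/lastP: h => // h m _ /legal_play_rcons[_ /andP[_]].
by rewrite position_rcons.
Qed.

Lemma pedge_distinguishing_inj c :
  {in colored c &, injective c} -> pedge_distinguishing c.
Proof.
move=> inj; apply/dinjective_edgesP=> x y z w _ _ Ax Ay Az Aw cx cy.
by rewrite (inj x z) // (inj y w).
Qed.

Lemma legal_first_two c x :
  #|colored c| <= 1 -> 1 < k -> x \notin colored c -> exists d, legal c (x, d).
Proof.
move=> c1 k1 xc; case: (exists_unused_color (leq_ltn_trans c1 k1)) => d dP.
exists d; rewrite /legal xc /=; apply: pedge_distinguishing_inj => y z.
rewrite !colored_make_move !inE !ffunE /=.
have [->|_] := eqVneq y x; have [->|_] := eqVneq z x => //=.
- by move=> _ _ /esym/eqP; rewrite (negPf (dP z)).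
- by move=> _ _ /eqP; rewrite (negPf (dP y)).
by move=> yc zc _; apply: (card_le1_eqP c1); rewrite inE.
Qed.

End Play.

(** * Vertices and adjacency of the wheel *)

Section Wheel.
Variables (n : nat) (n_ge4 : 4 <= n).
Local Notation W := (wheel n).

Definition hub : W := inr ord0.

Lemma eq_hub (x : 'I_1) : inr x = hub.
Proof. by rewrite ord1. Qed.

Lemma card_wheel : #|W| = n.
Proof. by rewrite card_sum !card_ord; case: n n_ge4 => // n' _; rewrite addn1. Qed.

Lemma neq_ordS (v : 'I_n.-1) : v != ordS v.
Proof.
rewrite -val_eqE /=; have lt_v := ltn_ord v.
have [lt_v1|] := ltnP v.+1 n.-1; first by rewrite modn_small // neq_ltn ltnSn.
rewrite leq_eqVlt ltnNge lt_v orbF => /eqP def_v.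
rewrite -def_v modnn -lt0n -ltnS -def_v.
by case: n n_ge4 => // n' /ltnW.
Qed.

(** After applying [ordS] to both sides, equality would mean [v + 2 = v] modulo [n - 1], which
    [n - 1 >= 3] forbids. *)
Lemma ordS_neq_ord_pred (v : 'I_n.-1) : ordS v != ord_pred v.
Proof.
rewrite -(inj_eq (can_inj (@ordSK _))) ord_predK; apply/negP => /eqP.
move/(congr1 val) => /=; have lt_v := ltn_ord v.
have m3 : 3 <= n.-1 by case: n n_ge4.
have -> : (v.+1 %% n.-1).+1 %% n.-1 = v.+2 %% n.-1.
  by rewrite -addn1 modnDml addn1.
have [lt2|ge2] := ltnP v.+2 n.-1.
  by rewrite modn_small // => /eqP; rewrite eqn_leq ltnNge leqnSn.
rewrite -(subnK ge2) modnDr modn_small; last first.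
  by rewrite ltn_subLR // -addn2 leq_add // ltnW.
move=> /eqP; rewrite eqn_leq => /andP[_].
by rewrite leqNgt ltn_subLR // -[(val v).+2]addn2 addnC ltn_add2r m3.
Qed.

Lemma adj_rim (v w : 'I_n.-1) :
  adj (inl v : W) (inl w) = (w == ordS v) || (w == ord_pred v).
Proof.
rewrite /= /cycle_adj -(inj_eq (can_inj (@ord_predK _)) v (ordS w)) ordSK.
rewrite [ord_pred v == w]eq_sym; case: (w =P ordS v) => [->|_] /=.
  by rewrite neq_ordS.
case: (w =P ord_pred v) => [->|_]; last by rewrite andbF.
by rewrite andbT -{1}[v]ord_predK eq_sym neq_ordS.
Qed.

(** * Color repetitions when the hub is colored *)

Section Coloring.
Variables (C : choiceType) (c : W -> C) (A : {set W}).
Hypothesis inj_c : dinjectiveb (induced_coloring c) (mem (edges_in A)).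
Hypothesis hubA : hub \in A.

Lemma rim_color_inj (v w : 'I_n.-1) :
  inl v \in A -> inl w \in A -> c (inl v) = c (inl w) -> v = w.
Proof.
move=> Av Aw cvw; have := dinjective_edgesP _ _ inj_c.
(* The spokes at [v] and [w] coincide, and [v] is the rim endpoint of the first. *)
move=> /(_ hub (inl v) hub (inl w) isT isT hubA Av hubA Aw erefl cvw).
by move/setP/(_ (inl v)); rewrite !inE eqxx orbT /= => /esym/eqP[].
Qed.

Lemma rim_color_neq_hub (v w : 'I_n.-1) :
  inl v \in A -> inl w \in A -> adj (inl v : W) (inl w) ->
  c (inl v) <> c hub.
Proof.
move=> Av Aw vw cv; have := dinjective_edgesP _ _ inj_c.
(* The rim edge [vw] and the spoke at [w] would coincide, but only the spoke contains [hub]. *)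
move=> /(_ (inl v) (inl w) hub (inl w) vw isT Av Aw hubA Aw cv erefl).
by move/setP/(_ hub); rewrite !inE eqxx.
Qed.

Lemma same_color_hub (x y : W) :
  x \in A -> y \in A -> c x = c y ->
  [\/ x = y, x = hub | y = hub].
Proof.
case: x y => [v|v] [w|w]; rewrite ?eq_hub => Ax Ay cxy; try by constructor.
by rewrite (rim_color_inj Ax Ay cxy); constructor.
Qed.

End Coloring.

(** In a total coloring every rim vertex [v] has a colored rim neighbor [ordS v], so none repeats
    the hub color; the coloring is then injective on all [n] vertices. *)
Lemma lambda_wheel_ge : n <= lambda W.
Proof.
rewrite /lambda; case: ex_minnP => k /andP[_ /existsP[c]] + _.
rewrite /edge_distinguishing -edges_inT => inj_c.
have neq_hub (v : 'I_n.-1) : c (inl v) <> c hub.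
  apply: (rim_color_neq_hub inj_c (in_setT hub) (in_setT _)).
    exact: (in_setT (inl (ordS v))).
  by rewrite adj_rim eqxx.
rewrite -card_wheel -[k in _ <= k]card_ord; apply: (@leq_card _ _ c) => x y cxy.
case: (same_color_hub inj_c (in_setT hub) (in_setT x) (in_setT y) cxy) => //.
- case: y cxy => [v|v] + x_hub; rewrite x_hub ?eq_hub //.
  by move/esym/neq_hub.
- case: x cxy => [v|v] + y_hub; rewrite y_hub ?eq_hub //.
  by move/neq_hub.
Qed.

(** * The game on the wheel with at least [n] colors *)

Section WheelGame.
Variables (k : nat) (le_nk : n <= k).
Implicit Types (c : pcoloring W k) (h : seq (move W k)).

(** Edges at [x] carry the fresh color [d], so they can only conflict with each other. Two of them
    conflict only if their other ends share a color, that is, if one end is the hub and the other a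
    rim neighbor of [x] repeating the hub color; the last hypothesis excludes this. *)
Lemma legal_unused_color c x d :
  pedge_distinguishing c -> hub \in colored c -> x \notin colored c ->
  (forall y, c y != Some d) ->
  (forall v : 'I_n.-1, c (inl v) = c hub -> ~~ adj (inl v : W) x) ->
  legal c (x, d).
Proof.
move=> inj_c hubc xc dP x_nadj; rewrite /legal xc /=.
have mmE y : y != x -> make_move c (x, d) y = c y.
  by move=> yx; rewrite ffunE (negPf yx).
have mmx : make_move c (x, d) x = Some d by rewrite ffunE eqxx.
have mm_eqx y : Some d = make_move c (x, d) y -> y = x.
  rewrite ffunE /=; case: eqP => // _ /esym/eqP; by rewrite (negPf (dP y)).
have nb_inj p q : adj x p -> adj x q -> p \in colored c -> q \in colored c ->
    c p = c q -> p = q.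
  move=> xp xq pc qc cpq; case: (same_color_hub inj_c hubc pc qc cpq) => // ehub.
  - rewrite ehub in cpq *; case: q xq {qc} cpq => [v|v] xq cpq; last by rewrite eq_hub.
    by have := x_nadj v (esym cpq); rewrite adj_sym xq.
  - rewrite ehub in cpq *; case: p xp {pc} cpq => [v|v] xp cpq; last by rewrite eq_hub.
    by have := x_nadj v cpq; rewrite adj_sym xp.
have adjx y : adj x y -> y != x by move/adj_neq; rewrite eq_sym.
apply/dinjective_edgesP=> p q r s pq rs; rewrite colored_make_move !in_setU1 /=.
(* As endpoints are compared in aligned order, the fresh color forces [x] into the same place in
   both edges; then [nb_inj] identifies the other ends. *)
case: (eqVneq p x) pq => [->|px] pq.
  move=> _ qc rc sc; rewrite mmx => /mm_eqx r_x; rewrite r_x in rs *.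
  rewrite (negPf (adjx _ pq)) in qc; rewrite (negPf (adjx _ rs)) in sc.
  by rewrite !mmE ?adjx // => /(nb_inj _ _ pq rs qc sc) ->.
case: (eqVneq q x) pq => [->|qx] pq.
  rewrite adj_sym in pq; rewrite adj_sym in rs.
  move=> pc _ rc sc cpr; rewrite mmx => /mm_eqx s_x; move: cpr.
  rewrite s_x in rs *; rewrite /= in pc.
  rewrite (negPf (adjx _ rs)) in rc.
  by rewrite !mmE ?adjx // => /(nb_inj _ _ pq rs pc rc) ->.
have [->|rx] := eqVneq r x.
  by move=> _ _ _ _; rewrite mmx => /esym/mm_eqx/eqP; rewrite (negPf px).
have [->|sx] := eqVneq s x.
  by move=> _ _ _ _ _; rewrite mmx => /esym/mm_eqx/eqP; rewrite (negPf qx).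
move=> pc qc rc sc; rewrite !mmE //.
exact: (dinjective_edgesP _ _ inj_c).
Qed.

Lemma odd_card_colored c :
  pedge_distinguishing c -> hub \in colored c ->
  (forall m, ~~ legal c m) -> odd #|colored c| = odd n.
Proof.
move=> inj_c hubc over.
have blocked x : x \notin colored c ->
    exists2 v : 'I_n.-1, c (inl v) = c hub & adj (inl v : W) x.
  move=> xc.
  have [|d dP] := @exists_unused_color _ k c.
    apply: leq_trans le_nk; rewrite -[n in _ < n]card_wheel -cardsT.
    apply: proper_card.
    by apply/properP; split; [apply: subsetT | exists x].
  have [/exists_inP[v /eqP cv vx]|no_v] :=
      boolP [exists (v : 'I_n.-1 | c (inl v) == c hub), adj (inl v : W) x].
    by exists v.
  case/negP: (over (x, d)); apply: legal_unused_color => // v cv.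
  by apply: contra no_v => vx; apply/exists_inP; exists v; rewrite ?cv.
have [full|] := boolP (colored c == setT).
  by rewrite (eqP full) cardsT card_wheel.
rewrite -subTset => /subsetPn[x _ /blocked[v cv _]].
have vc : inl v \in colored c by move: hubc; rewrite !inE cv.
(* A colored rim neighbor of [v] would contradict [rim_color_neq_hub]. Conversely, any uncolored
   vertex is blocked by some [w] with the hub color, and [w = v] by injectivity on the rim. *)
have -> : colored c = ~: [set inl (ordS v); inl (ord_pred v)].
  apply/setP=> y; rewrite in_setC; apply/idP/idP => [yc|].
    apply/negP; rewrite !inE => y_nb; case: y yc y_nb => [w|w] yc y_nb //.
    apply: (rim_color_neq_hub inj_c hubc vc yc) cv.
    by rewrite adj_rim.
  apply: contraR => /[dup] yc /blocked[w cw].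
  have wc : inl w \in colored c by move: hubc; rewrite !inE cw.
  rewrite (rim_color_inj inj_c hubc wc vc) ?cw ?cv //.
  case: y yc => [u|u] yc; last by rewrite eq_hub hubc in yc.
  by rewrite adj_rim !inE.
have := cardsC [set (inl (ordS v) : W); inl (ord_pred v)].
rewrite cards2 card_wheel (inj_eq (@inl_inj _ _)) ordS_neq_ord_pred.
by move/(congr1 odd) => <-; rewrite oddD.
Qed.

(** Strategies are total functions, so [m0] fills in for histories without a legal move. *)
Definition hub_first (m0 : move W k) : strategy W k := fun h =>
  if [pick m | legal (position h) m && (m.1 == hub)] is Some m then m else
  if [pick m | legal (position h) m] is Some m then m else m0.

Lemma legal_hub_first m0 h :
  ~ game_over h -> legal (position h) (hub_first m0 h).
Proof.
rewrite /hub_first => not_over; case: pickP => [m /andP[] //|_].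
case: pickP => // none; case: not_over => m; exact/negbT/none.
Qed.

Lemma hub_first_hub m0 h :
  legal_play h -> size h <= 1 -> hub \notin colored (position h) ->
  (hub_first m0 h).1 = hub.
Proof.
move=> lp h1 hubh; rewrite /hub_first; case: pickP => [m /andP[_ /eqP] //|].
have [|||d dP] := @legal_first_two _ k (position h) hub => //.
- by rewrite card_colored_position.
- by apply: leq_trans le_nk; apply: leq_trans n_ge4.
- by move/(_ (hub, d)); rewrite dP eqxx.
Qed.

(** The player who makes the last move of any nonempty play whose length has the parity of [n]. *)
Definition favored : player := if odd n then Player1 else Player2.

(** The first turn of [favored] comes after zero moves for odd [n] and after one move for even [n];
    if the hub is still uncolored then, [hub_first] colors it. *)
Lemma hub_colored m0 h :
  legal_play h -> follows favored (hub_first m0) h -> 1 < size h ->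
  hub \in colored (position h).
Proof.
rewrite colored_position inE => lp fol.
have colors_hub h1 m h2 : h = h1 ++ m :: h2 -> size h1 <= 1 ->
    to_move h1 = favored -> hub \in map fst h.
  move=> def_h h1_le1 turn; have lp1 : legal_play h1.
    by move=> g m1 g' def_h1; apply: (lp g m1 (g' ++ m :: h2));
       rewrite def_h def_h1 -catA.
  rewrite def_h map_cat mem_cat inE; have [//|hub_h1] := boolP (hub \in map fst h1).
  rewrite (fol _ _ _ def_h turn) hub_first_hub ?eqxx //.
  by rewrite colored_position inE.
case: h lp fol colors_hub => [|m1 [|m2 h]] // lp fol colors_hub _.
rewrite /favored in colors_hub; case: (boolP (odd n)) colors_hub => n_odd.
  by move/(_ [::] m1 (m2 :: h)); apply.
by move/(_ [:: m1] m2 h); apply.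
Qed.

Lemma hub_first_winning m0 : winning_strategy favored (hub_first m0).
Proof.
move=> h lp fol; split=> [not_over _|over]; first exact: legal_hub_first.
have hubh : hub \in colored (position h).
  (* A play of at most one move with the hub uncolored is not over, since the hub can still be
     colored legally. *)
  have [le1|gt1] := leqP (size h) 1; last exact: hub_colored fol gt1.
  apply/contraT => hubh.
  have [|||d dP] := @legal_first_two _ k (position h) hub => //.
  - by rewrite card_colored_position.
  - by apply: leq_trans le_nk; apply: leq_trans n_ge4.
  - by have := over (hub, d); rewrite dP.
have h_gt0 : 0 < size h.
  by move: hubh; rewrite colored_position; case: (h); rewrite ?inE.
have := odd_card_colored (pedge_distinguishing_position h_gt0 lp) hubh over.
rewrite card_colored_position //; case/lastP: h h_gt0 {lp fol over hubh} => // h m _.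
rewrite size_rcons /= => par; exists h, m; split=> //.
(* Here [h] is the play without its last move, so its length has the parity opposite to [n]. *)
by rewrite /to_move /favored -par; case: odd.
Qed.

End WheelGame.

Lemma favored_wins : has_winning_strategy W favored.
Proof.
have lam := lambda_wheel_ge.
(* The default move needs some color to exist. *)
have lam_gt0 : 0 < lambda W by apply: leq_trans lam; apply: leq_trans n_ge4.
by exists (hub_first (hub, Ordinal lam_gt0)); apply: hub_first_winning.
Qed.

End Wheel.

Theorem theorem3p5 (n : nat) (hn : 4 <= n) :
  (odd n -> has_winning_strategy (wheel n) Player1) /\
  (~~ odd n -> has_winning_strategy (wheel n) Player2).
Proof.
by have := favored_wins hn; rewrite /favored; case: (odd n); split.
Qed.
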